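(* Let $\mathcal{C}$ be a Markov category with monoidal unit $I$ such that every kernel $f : X \to Y$ has a Bayesian inverse at every state $p : I \to X$, and such that every state $p : I \to X$ has a support object. Then the projection functor $\mathbf{DBLens}(\mathcal{C}) \to \mathcal{C}$, $\binom{X}{A} \mapsto X$, $(f, f^\sharp) \mapsto f$, has a section: a (strict) functor $T : \mathcal{C} \to \mathbf{DBLens}(\mathcal{C})$ sending each kernel to the family of its Bayesian inverses between support objects. That is, $T(X) = \binom{X}{S_X}$, where $S_X : \mathcal{C}(I, X) \to \mathrm{Ob}(\mathcal{C})$ sends $p$ to a choice of support object $X_p$, and $T(f) = (f, f^\sharp)$ for $f : X \to Y$, where for each $p \in \mathcal{C}(I, X)$ the kernel $f^\sharp(p) : Y_{f \circ p} \to X_p$ is the Bayesian inverse with support of $f$ at $p$.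
   Context: A Markov category is a symmetric monoidal category $(\mathcal{C}, \otimes, I)$ in which every object $X$ carries a commutative comonoid structure $\mathrm{copy}_X : X \to X \otimes X$, $\mathrm{delete}_X : X \to I$, such that the maps $\mathrm{delete}_X$ are natural in $X$, and the copy maps are compatible with the monoidal structure ($\mathrm{copy}_{X \otimes Y}$ is $\mathrm{copy}_X \otimes \mathrm{copy}_Y$ followed by the symmetry exchanging the two middle factors). Morphisms of $\mathcal{C}$ are called kernels; a morphism $p : I \to X$ is called a state on $X$. Almost-sure equality: for $p : I \to X$ and $f, g : X \to Y$, write $f \simeq_p g$ if $(f \otimes \mathrm{id}_X) \circ \mathrm{copy}_X \circ p = (g \otimes \mathrm{id}_X) \circ \mathrm{copy}_X \circ p$. Bayesian inverse: for $f : X \to Y$ and $p : I \to X$, a kernel $f' : Y \to X$ is an (ordinary) Bayesian inverse of $f$ at $p$ if $(f' \otimes \mathrm{id}_Y) \circ \mathrm{copy}_Y \circ f \circ p = (\mathrm{id}_X \otimes f) \circ \mathrm{copy}_X \circ p$. Support: an object $X_p$ is a support of $p : I \to X$ if it represents the covariant functor $\mathcal{C}(X, -)/{\simeq_p} : \mathcal{C} \to \mathbf{Set}$. Whenever a support object $X_p$ is given, it is taken together with a choice of kernels $i_p : X_p \to X$ and $r_p : X \to X_p$ with $r_p \circ i_p = \mathrm{id}_{X_p}$ and such that for all $f, g : X \to Y$, $f \simeq_p g \iff f \circ i_p = g \circ i_p$ (such a pair always exists). Bayesian inverse with support: given $f : X \to Y$, $p : I \to X$ and support objects $X_p$, $Y_{f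 \circ p}$, a kernel $g : Y_{f \circ p} \to X_p$ is a Bayesian inverse with support of $f$ at $p$ if $\langle g \rangle := i_p \circ g \circ r_{f \circ p} : Y \to X$ is an ordinary Bayesian inverse of $f$ at $p$. (If $f$ has an ordinary Bayesian inverse at $p$, there is exactly one Bayesian inverse with support of $f$ at $p$.) Dependent Bayesian lenses: $\mathbf{DBLens}(\mathcal{C})$ is the category whose objects are pairs $\binom{X}{A}$ with $X$ an object of $\mathcal{C}$ and $A : \mathcal{C}(I, X) \to \mathrm{Ob}(\mathcal{C})$ a function, and whose morphisms $\binom{X}{A} \to \binom{Y}{B}$ are pairs $(f, f^\sharp)$ with $f : X \to Y$ a kernel and $f^\sharp$ a family of kernels $f^\sharp(p) : B(f \circ p) \to A(p)$ indexed by $p \in \mathcal{C}(I, X)$. The composite of $(f, f^\sharp) : \binom{X}{A} \to \binom{Y}{B}$ and $(g, g^\sharp) : \binom{Y}{B} \to \binom{Z}{C}$ is $g \circ f$ with the family $p \mapsto f^\sharp(p) \circ g^\sharp(f \circ p) : C(g \circ f \circ p) \to A(p)$; identities are $(\mathrm{id}_X, p \mapsto \mathrm{id}_{A(p)})$. *)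

(* Defs.v *)
(* Equality of morphisms is Leibniz equality throughout; hom-types are arbitrary types,
   without decidability or setoid structure. *)
From Stdlib Require Import FunctionalExtensionality PropExtensionality ProofIrrelevance.

Set Implicit Arguments.
Unset Strict Implicit.
Unset Printing Implicit Defensive.

Declare Scope cat_scope.
Delimit Scope cat_scope with cat.
Local Open Scope cat_scope.
Local Obligation Tactic := idtac.

Record Category := {
  Ob :> Type;
  Hom : Ob -> Ob -> Type;
  idm : forall X, Hom X X;
  comp : forall X Y Z, Hom Y Z -> Hom X Y -> Hom X Z;
  comp_idl : forall X Y (f : Hom X Y), comp (idm Y) f = f;
  comp_idr : forall X Y (f : Hom X Y), comp f (idm X) = f;
  comp_assoc : forall X Y Z W (h : Hom Z W) (g : Hom Y Z) (f : Hom X Y),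
    comp (comp h g) f = comp h (comp g f) }.

Arguments Hom {c} X Y.
Arguments idm {c} X.
Arguments comp {c X Y Z} g f.
Arguments comp_idl {c X Y} f.
Arguments comp_idr {c X Y} f.
Arguments comp_assoc {c X Y Z W} h g f.

Notation "g ∘ f" := (comp g f) (at level 40, left associativity) : cat_scope.

(* The data of a functor is kept apart from its laws, so that two functors can be
   compared on objects and morphisms at once by Leibniz equality of their data. *)
Record FunctorData (C D : Category) := {
  fobj : C -> D;
  fmap : forall X Y : C, Hom X Y -> Hom (fobj X) (fobj Y) }.

Record Functor (C D : Category) := {
  fdata :> FunctorData C D;
  fmap_id : forall X : C, fmap fdata (idm X) = idm (fobj fdata X);
  fmap_comp : forall (X Y Z : C) (g : Hom Y Z) (f : Hom X Y),
    fmap fdata (g ∘ f) = fmap fdata g ∘ fmap fdata f }.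

Arguments fobj {C D} _ X.
Arguments fmap {C D} _ {X Y} f.

Definition functor_id (C : Category) : Functor C C :=
  {| fdata := {| fobj := fun X => X; fmap := fun X Y f => f |};
     fmap_id := fun X => eq_refl;
     fmap_comp := fun X Y Z g f => eq_refl |}.

Program Definition functor_comp (C D E : Category) (G : Functor D E) (F : Functor C D) :
    Functor C E :=
  {| fdata := {| fobj := fun X => fobj G (fobj F X);
                 fmap := fun X Y f => fmap G (fmap F f) |} |}.
Next Obligation. intros; simpl; now rewrite !fmap_id. Qed.
Next Obligation. intros; simpl; now rewrite !fmap_comp. Qed.

Definition is_section (C D : Category) (P : Functor D C) (T : Functor C D) : Prop :=
  functor_comp P T = functor_id C.

Record NatIso (C D : Category) (F G : Functor C D) := {
  ni_hom : forall X : C, Hom (fobj F X) (fobj G X);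
  ni_inv : forall X : C, Hom (fobj G X) (fobj F X);
  ni_natural : forall (X Y : C) (f : Hom X Y), ni_hom Y ∘ fmap F f = fmap G f ∘ ni_hom X;
  ni_hom_inv : forall X : C, ni_hom X ∘ ni_inv X = idm (fobj G X);
  ni_inv_hom : forall X : C, ni_inv X ∘ ni_hom X = idm (fobj F X) }.

(* The category of sets. *)
Definition SetCat : Category :=
  {| Ob := Type;
     Hom := fun A B => A -> B;
     idm := fun A x => x;
     comp := fun A B C g f x => g (f x);
     comp_idl := fun A B f => eq_refl;
     comp_idr := fun A B f => eq_refl;
     comp_assoc := fun A B C D h g f => eq_refl |}.

Program Definition hom_functor (C : Category) (A : C) : Functor C SetCat :=
  {| fdata := {| fobj := fun Y : C => (Hom A Y : SetCat);
                 fmap := fun (Y Z : C) (h : Hom Y Z) (f : Hom A Y) => h ∘ f |} |}.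
Next Obligation. intros; extensionality f; apply comp_idl. Qed.
Next Obligation. intros; extensionality k; apply comp_assoc. Qed.

Definition represents (C : Category) (F : Functor C SetCat) (A : C) : Prop :=
  inhabited (NatIso (hom_functor A) F).

Record MonoidalCategory := {
  mcat :> Category;
  munit : mcat;
  tens : mcat -> mcat -> mcat;
  tensm : forall X X' Y Y' : mcat, Hom X X' -> Hom Y Y' -> Hom (tens X Y) (tens X' Y');
  tensm_id : forall X Y, tensm (idm X) (idm Y) = idm (tens X Y);
  tensm_comp : forall X X' X'' Y Y' Y'' (f : Hom X X') (f' : Hom X' X'')
      (g : Hom Y Y') (g' : Hom Y' Y''),
    tensm (f' ∘ f) (g' ∘ g) = tensm f' g' ∘ tensm f g;
  assoc : forall X Y Z, Hom (tens (tens X Y) Z) (tens X (tens Y Z));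
  assoc_inv : forall X Y Z, Hom (tens X (tens Y Z)) (tens (tens X Y) Z);
  lunit : forall X, Hom (tens munit X) X;
  lunit_inv : forall X, Hom X (tens munit X);
  runit : forall X, Hom (tens X munit) X;
  runit_inv : forall X, Hom X (tens X munit);
  assocK : forall X Y Z, assoc_inv X Y Z ∘ assoc X Y Z = idm _;
  assoc_invK : forall X Y Z, assoc X Y Z ∘ assoc_inv X Y Z = idm _;
  lunitK : forall X, lunit_inv X ∘ lunit X = idm _;
  lunit_invK : forall X, lunit X ∘ lunit_inv X = idm _;
  runitK : forall X, runit_inv X ∘ runit X = idm _;
  runit_invK : forall X, runit X ∘ runit_inv X = idm _;
  assoc_natural : forall X X' Y Y' Z Z' (f : Hom X X') (g : Hom Y Y') (h : Hom Z Z'),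
    assoc X' Y' Z' ∘ tensm (tensm f g) h = tensm f (tensm g h) ∘ assoc X Y Z;
  lunit_natural : forall X X' (f : Hom X X'),
    lunit X' ∘ tensm (idm munit) f = f ∘ lunit X;
  runit_natural : forall X X' (f : Hom X X'),
    runit X' ∘ tensm f (idm munit) = f ∘ runit X;
  pentagon : forall W X Y Z,
    assoc W X (tens Y Z) ∘ assoc (tens W X) Y Z
    = tensm (idm W) (assoc X Y Z) ∘ assoc W (tens X Y) Z ∘ tensm (assoc W X Y) (idm Z);
  triangle : forall X Y,
    tensm (idm X) (lunit Y) ∘ assoc X munit Y = tensm (runit X) (idm Y) }.

Arguments munit {_}.
Arguments tens {_} X Y.
Arguments tensm {_ X X' Y Y'} f g.
Arguments assoc {_} X Y Z.
Arguments assoc_inv {_} X Y Z.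
Arguments lunit {_} X.
Arguments lunit_inv {_} X.
Arguments runit {_} X.
Arguments runit_inv {_} X.

Notation "X ⊗ Y" := (tens X Y) (at level 39, left associativity) : cat_scope.
Notation "f ⊠ g" := (tensm f g) (at level 39, left associativity) : cat_scope.

Record SymmetricMonoidalCategory := {
  smcat :> MonoidalCategory;
  swap : forall X Y : smcat, Hom (X ⊗ Y) (Y ⊗ X);
  swap_natural : forall (X X' Y Y' : smcat) (f : Hom X X') (g : Hom Y Y'),
    swap X' Y' ∘ (f ⊠ g) = (g ⊠ f) ∘ swap X Y;
  swapK : forall X Y : smcat, swap Y X ∘ swap X Y = idm (X ⊗ Y);
  hexagon : forall X Y Z : smcat,
    assoc Y Z X ∘ swap X (Y ⊗ Z) ∘ assoc X Y Z
    = (idm Y ⊠ swap X Z) ∘ assoc Y X Z ∘ (swap X Y ⊠ idm Z) }.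

Arguments swap {_} X Y.

Definition mid_swap (C : SymmetricMonoidalCategory) (A B X Y : C) :
    Hom ((A ⊗ B) ⊗ (X ⊗ Y)) ((A ⊗ X) ⊗ (B ⊗ Y)) :=
  assoc_inv A X (B ⊗ Y)
  ∘ (idm A ⊠ assoc X B Y)
  ∘ (idm A ⊠ (swap B X ⊠ idm Y))
  ∘ (idm A ⊠ assoc_inv B X Y)
  ∘ assoc A B (X ⊗ Y).

(* [del_natural] is naturality of [del] from the identity functor to the constant functor
   at [munit].  With the counit laws it makes [munit] terminal, so that the compatibility
   of [del] with the tensor and the laws for [copy munit] and [del munit] need not be
   required separately. *)
Record MarkovCategory := {
  mkcat :> SymmetricMonoidalCategory;
  copy : forall X : mkcat, Hom X (X ⊗ X);
  del : forall X : mkcat, Hom X munit;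
  copy_assoc : forall X : mkcat,
    assoc X X X ∘ (copy X ⊠ idm X) ∘ copy X = (idm X ⊠ copy X) ∘ copy X;
  copy_counitl : forall X : mkcat, lunit X ∘ (del X ⊠ idm X) ∘ copy X = idm X;
  copy_counitr : forall X : mkcat, runit X ∘ (idm X ⊠ del X) ∘ copy X = idm X;
  copy_comm : forall X : mkcat, swap X X ∘ copy X = copy X;
  del_natural : forall (X Y : mkcat) (f : Hom X Y), del Y ∘ f = del X;
  copy_tens : forall X Y : mkcat, copy (X ⊗ Y) = mid_swap X X Y Y ∘ (copy X ⊠ copy Y) }.

Arguments copy {_} X.
Arguments del {_} X.

Definition state (C : MarkovCategory) (X : C) : Type := Hom (munit : C) X.

Definition ase (C : MarkovCategory) (X Y : C) (p : state X) (f g : Hom X Y) : Prop :=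
  (f ⊠ idm X) ∘ copy X ∘ p = (g ⊠ idm X) ∘ copy X ∘ p.

Definition bayes_inverse (C : MarkovCategory) (X Y : C) (f : Hom X Y) (p : state X)
    (f' : Hom Y X) : Prop :=
  (f' ⊠ idm Y) ∘ copy Y ∘ f ∘ p = (idm X ⊠ f) ∘ copy X ∘ p.

Lemma ase_comp (C : MarkovCategory) (X Y Z : C) (p : state X) (h : Hom Y Z)
    (f g : Hom X Y) : ase p f g -> ase p (h ∘ f) (h ∘ g).
Proof.
  assert (E : forall k : Hom X Y, (h ∘ k) ⊠ idm X = (h ⊠ idm X) ∘ (k ⊠ idm X)).
  { intros k; rewrite <- tensm_comp, comp_idl; reflexivity. }
  unfold ase; intros H; rewrite !E, !comp_assoc.
  rewrite !comp_assoc in H; now rewrite H.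
Qed.

(* The quotient [C(X, Y) / ase p], as the type of equivalence classes. *)
Definition ase_quot (C : MarkovCategory) (X : C) (p : state X) (Y : C) : Type :=
  {S : Hom X Y -> Prop | exists f : Hom X Y, S = ase p f}.

(* The class of [h ∘ f], for [f] any member of the class [S]. *)
Program Definition ase_quot_map (C : MarkovCategory) (X : C) (p : state X) (Y Z : C)
    (h : Hom Y Z) (S : ase_quot p Y) : ase_quot p Z :=
  fun k => exists f : Hom X Y, proj1_sig S f /\ ase p (h ∘ f) k.
Next Obligation.
  intros C X p Y Z h [S [f ->]]; exists (h ∘ f); simpl.
  extensionality k; apply propositional_extensionality; split.
  - intros [f' [Hf Hk]]; exact (eq_trans (ase_comp h Hf) Hk).
  - intros Hk; exists f; split; [reflexivity | exact Hk].
Qed.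

Lemma ase_quot_eq (C : MarkovCategory) (X : C) (p : state X) (Y : C) (S S' : ase_quot p Y) :
  (forall k, proj1_sig S k <-> proj1_sig S' k) -> S = S'.
Proof.
  destruct S as [S HS], S' as [S' HS']; simpl; intros H.
  assert (E : S = S') by (extensionality k; apply propositional_extensionality; apply H).
  subst S'; f_equal; apply proof_irrelevance.
Qed.

Program Definition ase_functor (C : MarkovCategory) (X : C) (p : state X) :
    Functor C SetCat :=
  {| fdata := {| fobj := fun Y : C => (ase_quot p Y : SetCat);
                 fmap := fun (Y Z : C) (h : Hom Y Z) => ase_quot_map (p := p) h |} |}.
Next Obligation.
  intros C X p Y; extensionality S; apply ase_quot_eq; intros k.
  destruct S as [S [f ->]]; simpl; split.
  - intros [f' [Hf Hk]]; rewrite comp_idl in Hk; exact (eq_trans Hf Hk).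
  - intros Hk; exists k; split; [exact Hk | rewrite comp_idl; reflexivity].
Qed.
Next Obligation.
  intros C X p Y Z W g f; extensionality S; apply ase_quot_eq; intros k.
  destruct S as [S [u ->]]; simpl; split.
  - intros [v [Hv Hk]]; exists (f ∘ v); split.
    + exists v; split; [exact Hv | reflexivity].
    + rewrite comp_assoc in Hk; exact Hk.
  - intros [w [[v [Hv Hw]] Hk]]; exists v; split; [exact Hv |].
    rewrite comp_assoc; exact (eq_trans (ase_comp g Hw) Hk).
Qed.

Definition is_support (C : MarkovCategory) (X : C) (p : state X) (Xp : C) : Prop :=
  represents (ase_functor p) Xp.

(* A support object together with its chosen kernels. *)
Record Support (C : MarkovCategory) (X : C) (p : state X) := {
  supp :> C;
  supp_is_support : is_support p supp;
  supp_i : Hom supp X;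
  supp_r : Hom X supp;
  supp_ri : supp_r ∘ supp_i = idm supp;
  supp_ase : forall (Y : C) (f g : Hom X Y), ase p f g <-> f ∘ supp_i = g ∘ supp_i }.

Definition supp_extend (C : MarkovCategory) (X Y : C) (p : state X) (q : state Y)
    (Xp : Support p) (Yq : Support q) (g : Hom Yq Xp) : Hom Y X :=
  supp_i Xp ∘ g ∘ supp_r Yq.

Definition bayes_inverse_supp (C : MarkovCategory) (X Y : C) (f : Hom X Y) (p : state X)
    (Xp : Support p) (Yfp : Support (f ∘ p)) (g : Hom Yfp Xp) : Prop :=
  bayes_inverse f p (supp_extend g).

(* The identity, seen as a morphism between two equal objects. *)
Definition hom_of_eq (C : Category) (X Y : C) (e : X = Y) : Hom X Y :=
  eq_rect X (fun Z => Hom X Z) (idm X) Y e.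

Record LensOb (C : MarkovCategory) := {
  lbase : C;
  lfib : state lbase -> C }.

Record Lens (C : MarkovCategory) (U V : LensOb C) := {
  lfwd : Hom (lbase U) (lbase V);
  lbwd : forall p : state (lbase U), Hom (lfib (l := V) (lfwd ∘ p)) (lfib (l := U) p) }.

Arguments lfib {C} _ p.
Arguments lbwd {C U V} _ p.

(* The unit and associativity laws of [C] hold only propositionally, hence the
   coercions along [comp_idl] and [comp_assoc]. *)
Definition lens_id (C : MarkovCategory) (U : LensOb C) : Lens U U :=
  {| lfwd := idm (lbase U);
     lbwd := fun p : state (lbase U) => hom_of_eq (f_equal (lfib U) (comp_idl p)) |}.

Definition lens_comp (C : MarkovCategory) (U V W : LensOb C) (g : Lens V W) (f : Lens U V) :
    Lens U W :=
  {| lfwd := lfwd g ∘ lfwd f;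
     lbwd := fun p : state (lbase U) =>
       lbwd f p ∘ lbwd g (lfwd f ∘ p)
       ∘ hom_of_eq (f_equal (lfib W) (comp_assoc (lfwd g) (lfwd f) p)) |}.

Lemma hom_of_eq_refl (C : Category) (X : C) (e : X = X) : hom_of_eq e = idm X.
Proof. now rewrite (proof_irrelevance _ e eq_refl). Qed.

Lemma hom_of_eq_trans (C : Category) (X Y Z : C) (e : X = Y) (e' : Y = Z) :
  hom_of_eq e' ∘ hom_of_eq e = hom_of_eq (eq_trans e e').
Proof. destruct e', e; simpl; apply comp_idl. Qed.

Lemma lbwd_hom_of_eq (C : MarkovCategory) (U V : LensOb C) (f : Lens U V)
    (p q : state (lbase U)) (e : p = q) (e1 : lfib U p = lfib U q)
    (e2 : lfib V (lfwd f ∘ p) = lfib V (lfwd f ∘ q)) :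
  hom_of_eq e1 ∘ lbwd f p = lbwd f q ∘ hom_of_eq e2.
Proof. destruct e; now rewrite !hom_of_eq_refl, comp_idl, comp_idr. Qed.

Lemma lens_eq (C : MarkovCategory) (U V : LensOb C) (f g : Lens U V)
    (e : lfwd f = lfwd g) :
  (forall p, lbwd f p
     = lbwd g p ∘ hom_of_eq (f_equal (fun h : Hom (lbase U) (lbase V) => lfib V (h ∘ p)) e)) ->
  f = g.
Proof.
  destruct f as [f fb], g as [g gb]; simpl in *; destruct e; intros H.
  f_equal; extensionality p; rewrite (H p); apply comp_idr.
Qed.

Lemma lens_comp_idl (C : MarkovCategory) (U V : LensOb C) (f : Lens U V) :
  lens_comp (lens_id V) f = f.
Proof.
  apply (@lens_eq C U V (lens_comp (lens_id V) f) f (comp_idl (lfwd f))); intros p; simpl.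
  etransitivity; [apply comp_assoc |].
  rewrite hom_of_eq_trans; do 2 f_equal; apply proof_irrelevance.
Qed.

Lemma lens_comp_idr (C : MarkovCategory) (U V : LensOb C) (f : Lens U V) :
  lens_comp f (lens_id U) = f.
Proof.
  apply (@lens_eq C U V (lens_comp f (lens_id U)) f (comp_idr (lfwd f))); intros p; simpl.
  rewrite (@lbwd_hom_of_eq C U V f _ _ (comp_idl p) _
             (f_equal (fun q => lfib V (lfwd f ∘ q)) (comp_idl p))).
  etransitivity; [apply comp_assoc |].
  rewrite hom_of_eq_trans; do 2 f_equal; apply proof_irrelevance.
Qed.

Lemma lens_comp_assoc_aux (C : Category) (A0 A1 A2 A3 A4 A5 A6 A7 A8 : C)
    (a : Hom A1 A0) (b : Hom A2 A1) (c : Hom A3 A2) (c1 : Hom A4 A3) (c2 : Hom A5 A4)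
    (c3 : Hom A7 A2) (d : Hom A6 A7) (k : Hom A6 A3) (c4 : Hom A8 A6) (c5 : Hom A5 A8) :
  c3 ∘ d = c ∘ k -> c1 ∘ c2 = k ∘ c4 ∘ c5 ->
  a ∘ (b ∘ c ∘ c1) ∘ c2 = a ∘ b ∘ c3 ∘ d ∘ c4 ∘ c5.
Proof.
  intros H1 H2; rewrite !comp_assoc, H2, !comp_assoc.
  rewrite <- (comp_assoc c3), H1, !comp_assoc; reflexivity.
Qed.

Lemma lens_comp_assoc (C : MarkovCategory) (U V W Z : LensOb C)
    (h : Lens W Z) (g : Lens V W) (f : Lens U V) :
  lens_comp (lens_comp h g) f = lens_comp h (lens_comp g f).
Proof.
  apply (@lens_eq C U Z (lens_comp (lens_comp h g) f) (lens_comp h (lens_comp g f))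
           (comp_assoc (lfwd h) (lfwd g) (lfwd f))); intros p; simpl.
  eapply lens_comp_assoc_aux.
  - exact (@lbwd_hom_of_eq C W Z h _ _ (comp_assoc (lfwd g) (lfwd f) p) _
       (f_equal (fun q => lfib Z (lfwd h ∘ q)) (comp_assoc (lfwd g) (lfwd f) p))).
  - rewrite !hom_of_eq_trans; f_equal; apply proof_irrelevance.
Qed.

Definition DBLens (C : MarkovCategory) : Category :=
  {| Ob := LensOb C;
     Hom := @Lens C;
     idm := @lens_id C;
     comp := fun U V W g f => lens_comp g f;
     comp_idl := @lens_comp_idl C;
     comp_idr := @lens_comp_idr C;
     comp_assoc := @lens_comp_assoc C |}.

Definition lens_proj (C : MarkovCategory) : Functor (DBLens C) C :=
  {| fdata := {| fobj := fun U : DBLens C => lbase (U : LensOb C);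
                 fmap := fun (U V : DBLens C) (f : Hom U V) => lfwd (f : Lens U V) |};
     fmap_id := fun U => eq_refl;
     fmap_comp := fun U V W g f => eq_refl |}.

(* The object [(X, S_X)] and the lens [(f, f#)] attached to a choice [S] of supports and
   to a family [fs] of kernels between them. *)
Definition support_lens_ob (C : MarkovCategory)
    (S : forall (X : C) (p : state X), Support p) (X : C) : DBLens C :=
  {| lbase := X; lfib := fun p : state X => supp (S X p) |}.

Definition support_lens (C : MarkovCategory)
    (S : forall (X : C) (p : state X), Support p)
    (fs : forall (X Y : C) (f : Hom X Y) (p : state X), Hom (S Y (f ∘ p) : C) (S X p))
    (X Y : C) (f : Hom X Y) : Hom (support_lens_ob S X) (support_lens_ob S Y) :=
  Build_Lens (U := support_lens_ob S X) (V := support_lens_ob S Y) (fs X Y f).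

(* Main.v *)
Require Import Defs.
From Stdlib Require Import ClassicalEpsilon.
Set Implicit Arguments.
Local Open Scope cat_scope.

(** Write [i_p], [r_p] for the kernels of a support of [p] and, for [q = f ∘ p] and [g] a
    kernel from the support of [q] to that of [p], [<g> = i_p ∘ g ∘ r_q].

    A representation of [C(X, -)/ase p] gives these kernels by the Yoneda lemma: [r_p] is a
    representative of the universal class and [i_p] the element classifying [idm X]
    ([support_of_is_support]).  The point of a support is that the idempotent [i_p ∘ r_p] is
    [p]-almost surely the identity ([supp_idem_ase]).

    The ordinary Bayesian inverses of [f] at [p] form one class of [q]-almost sure equality
    ([bayes_inverse_ase]), and an inverse [f'] may be modified by anything almost surely
    trivial on either side: precomposing with [i_q ∘ r_q] changes it only up to almost sure
    equality, while a postcomposed [i_p ∘ r_p] slides through the defining equation to the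
    other side, where it meets [copy X ∘ p].  So [r_p ∘ f' ∘ i_q] is an inverse between
    supports.  It is unique there, because [g] is recovered from the almost sure class of
    [<g>] by restricting along [i_q] and retracting along [r_p]
    ([bayes_inverse_supp_exists], [bayes_inverse_supp_unique]).

    Uniqueness turns almost sure functoriality into strict functoriality.  The identity is
    an inverse of the identity, inverses compose contravariantly ([bayes_inverse_comp]), and
    [<g ∘ h> = <g> ∘ <h>] since [r ∘ i = idm] at the middle support; hence the functor laws
    hold as equations between inverses with support.  In [DBLens C] these equations involve
    coercions along [comp_idl] and [comp_assoc], which [supp_r] absorbs
    ([hom_of_eq_supp_r]). *)

(** The Yoneda lemma for the covariant functor [ase_functor p]: [r] represents the image of
    [idm Xp], and [i] is the preimage of the class of [idm X]. *)
Lemma support_of_is_support (C : MarkovCategory) (X : C) (p : state X) (Xp : C) :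
  is_support p Xp -> inhabited (Support p).
Proof.
  intros Hsupp; pose proof Hsupp as [N].
  pose (cls := fun (Y : C) (f : Hom X Y) =>
    (exist _ (ase p f) (ex_intro _ f eq_refl) : ase_quot p Y)).
  assert (cls_eq : forall (Y : C) (f g : Hom X Y), ase p f g <-> cls Y f = cls Y g).
  { intros Y f g; split; intros H.
    - apply ase_quot_eq; intros k; simpl; unfold ase in *; rewrite H; tauto.
    - assert (Hg : proj1_sig (cls Y g) g) by reflexivity.
      rewrite <- H in Hg; exact Hg. }
  assert (cls_map : forall (Y Z : C) (h : Hom Y Z) (f : Hom X Y),
    fmap (ase_functor p) h (cls Y f) = cls Z (h ∘ f)).
  { intros Y Z h f; apply ase_quot_eq; intros k; simpl; split.
    - intros [f' [Hf Hk]]; exact (eq_trans (ase_comp h Hf) Hk).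
    - intros Hk; exists f; split; [reflexivity | exact Hk]. }
  assert (nat : forall (Y Z : C) (h : Hom Y Z) (u : Hom Xp Y),
    ni_hom N Z (h ∘ u) = fmap (ase_functor p) h (ni_hom N Y u)).
  { intros Y Z h u; exact (f_equal (fun F => F u) (ni_natural N h)). }
  assert (hom_inv : forall (Y : C) (s : ase_quot p Y), ni_hom N Y (ni_inv N Y s) = s).
  { intros Y s; exact (f_equal (fun F => F s) (ni_hom_inv N Y)). }
  assert (hom_inj : forall (Y : C) (u v : Hom Xp Y), ni_hom N Y u = ni_hom N Y v -> u = v).
  { intros Y u v H.
    assert (K : forall w, ni_inv N Y (ni_hom N Y w) = w)
      by (intros w; exact (f_equal (fun F => F w) (ni_inv_hom N Y))).
    rewrite <- (K u), H; apply K. }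
  pose (i := ni_inv N X (cls X (idm X)) : Hom Xp X).
  (* The classes [cls Y f] exhaust the functor and [cls X (idm X)] maps to them all, so [i]
     determines the whole isomorphism. *)
  assert (hom_i : forall (Y : C) (f : Hom X Y), ni_hom N Y (f ∘ i) = cls Y f).
  { intros Y f; rewrite nat; unfold i; rewrite hom_inv, cls_map, comp_idr; reflexivity. }
  assert (R : exists r : Hom X Xp, ni_hom N Xp (idm Xp) = cls Xp r).
  { destruct (ni_hom N Xp (idm Xp)) as [S [r HS]]; exists r.
    apply ase_quot_eq; intros k; simpl; rewrite HS; tauto. }
  destruct R as [r Hr].
  constructor; refine (@Build_Support C X p Xp Hsupp i r _ _).
  - apply hom_inj; rewrite hom_i; symmetry; exact Hr.
  - intros Y f g; rewrite cls_eq, <- !hom_i; split.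
    + apply hom_inj.
    + intros ->; reflexivity.
Qed.

Lemma supp_idem_ase (C : MarkovCategory) (X : C) (p : state X) (Xp : Support p) :
  ase p (supp_i Xp ∘ supp_r Xp) (idm X).
Proof.
  apply (supp_ase Xp); now rewrite comp_assoc, supp_ri, comp_idl, comp_idr.
Qed.

Lemma tensm_compl (C : MonoidalCategory) (X Y Z W : C) (g : Hom Y Z) (f : Hom X Y) :
  (g ∘ f) ⊠ idm W = (g ⊠ idm W) ∘ (f ⊠ idm W).
Proof. now rewrite <- tensm_comp, comp_idl. Qed.

Lemma tensm_compr (C : MonoidalCategory) (X Y Z W : C) (g : Hom Y Z) (f : Hom X Y) :
  idm W ⊠ (g ∘ f) = (idm W ⊠ g) ∘ (idm W ⊠ f).
Proof. now rewrite <- tensm_comp, comp_idl. Qed.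

Lemma tensm_interchange (C : MonoidalCategory) (X X' Y Y' : C) (f : Hom X X')
    (g : Hom Y Y') :
  (f ⊠ idm Y') ∘ (idm X ⊠ g) = (idm X' ⊠ g) ∘ (f ⊠ idm Y).
Proof. now rewrite <- !tensm_comp, !comp_idl, !comp_idr. Qed.

(** The right-hand side of the defining equation does not mention the inverse, so two inverses
    have the same left-hand side, which is almost sure equality. *)
Lemma bayes_inverse_ase (C : MarkovCategory) (X Y : C) (f : Hom X Y) (p : state X)
    (f' f'' : Hom Y X) :
  bayes_inverse f p f' -> (bayes_inverse f p f'' <-> ase (f ∘ p) f'' f').
Proof.
  unfold bayes_inverse, ase; rewrite <- !comp_assoc; intros <-; reflexivity.
Qed.

Lemma ase_precomp (C : MarkovCategory) (X Y : C) (p : state X) (h : Hom X Y)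
    (e : Hom X X) : ase p e (idm X) -> ase p (h ∘ e) h.
Proof. intros H; pose proof (ase_comp h H) as K; now rewrite comp_idr in K. Qed.

(** In the defining equation, [e] acts on the factor [X] and [f] on the other copy, so they
    commute and [e] is absorbed by [copy X ∘ p]. *)
Lemma bayes_inverse_postcomp (C : MarkovCategory) (X Y : C) (f : Hom X Y) (p : state X)
    (f' : Hom Y X) (e : Hom X X) :
  bayes_inverse f p f' -> ase p e (idm X) -> bayes_inverse f p (e ∘ f').
Proof.
  unfold bayes_inverse, ase; intros Hf He.
  rewrite tensm_id, comp_idl in He.
  rewrite tensm_compl, !comp_assoc; rewrite !comp_assoc in Hf; rewrite !comp_assoc in He.
  rewrite Hf, <- comp_assoc, tensm_interchange, comp_assoc, He; reflexivity.
Qed.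

(** [g] and [f'] act on different copies of [Y], so the equation for [g] can be applied
    first and the one for [f] after interchanging them. *)
Lemma bayes_inverse_comp (C : MarkovCategory) (X Y Z : C) (f : Hom X Y) (g : Hom Y Z)
    (p : state X) (f' : Hom Y X) (g' : Hom Z Y) :
  bayes_inverse f p f' -> bayes_inverse g (f ∘ p) g' ->
  bayes_inverse (g ∘ f) p (f' ∘ g').
Proof.
  unfold bayes_inverse; intros Hf Hg.
  rewrite tensm_compl, tensm_compr, !comp_assoc; rewrite !comp_assoc in Hf; rewrite !comp_assoc in Hg.
  rewrite Hg, <- comp_assoc, tensm_interchange, comp_assoc, Hf; reflexivity.
Qed.

(** Restricting [f'] along [i] and retracting along [r] loses nothing, since the extension
    of the result is [f'] with the idempotents [i ∘ r] composed on both sides. *)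
Lemma bayes_inverse_supp_exists (C : MarkovCategory) (X Y : C) (f : Hom X Y)
    (p : state X) (Xp : Support p) (Yfp : Support (f ∘ p)) (f' : Hom Y X) :
  bayes_inverse f p f' ->
  bayes_inverse_supp (Xp := Xp) (Yfp := Yfp) (supp_r Xp ∘ f' ∘ supp_i Yfp).
Proof.
  intros Hf; unfold bayes_inverse_supp, supp_extend.
  pose proof (bayes_inverse_postcomp Hf (supp_idem_ase Xp)) as Hl.
  apply (bayes_inverse_ase _ Hl).
  pose proof (ase_precomp _ (supp_i Xp ∘ supp_r Xp ∘ f') (supp_idem_ase Yfp)) as Hr.
  rewrite !comp_assoc in Hr; rewrite !comp_assoc; exact Hr.
Qed.

(** The extensions are almost surely equal, hence agree after [supp_i Yfp]; there they are
    [supp_i Xp ∘ g] and [supp_i Xp ∘ h], and [supp_i Xp] is a split monomorphism. *)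
Lemma bayes_inverse_supp_unique (C : MarkovCategory) (X Y : C) (f : Hom X Y)
    (p : state X) (Xp : Support p) (Yfp : Support (f ∘ p)) (g h : Hom Yfp Xp) :
  bayes_inverse_supp g -> bayes_inverse_supp h -> g = h.
Proof.
  unfold bayes_inverse_supp, supp_extend; intros Hg Hh.
  apply (bayes_inverse_ase _ Hh) in Hg; apply (supp_ase Yfp) in Hg.
  apply (f_equal (fun k => supp_r Xp ∘ k)) in Hg.
  rewrite !comp_assoc, !supp_ri, !comp_idr, <- !comp_assoc, !supp_ri, !comp_idl in Hg.
  exact Hg.
Qed.

(** The chosen retractions depend on the state alone, so they transport along equations of
    states; [e] is arbitrary to cover every coercion that occurs in [DBLens C]. *)
Lemma hom_of_eq_supp_r (C : MarkovCategory)
    (S : forall (X : C) (p : state X), Support p) (X : C) (q p : state X)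
    (e : supp (S X q) = supp (S X p)) :
  q = p -> hom_of_eq e ∘ supp_r (S X q) = supp_r (S X p).
Proof. intros H; destruct H; now rewrite hom_of_eq_refl, comp_idl. Qed.

Lemma bayes_inverse_supp_id (C : MarkovCategory)
    (S : forall (X : C) (p : state X), Support p) (X : C) (p : state X)
    (e : supp (S X (idm X ∘ p)) = supp (S X p)) :
  bayes_inverse_supp (f := idm X) (Xp := S X p) (Yfp := S X (idm X ∘ p)) (hom_of_eq e).
Proof.
  unfold bayes_inverse_supp, supp_extend.
  rewrite comp_assoc, hom_of_eq_supp_r by apply comp_idl.
  unfold bayes_inverse; rewrite comp_idr; apply supp_idem_ase.
Qed.

Lemma bayes_inverse_supp_comp (C : MarkovCategory)
    (S : forall (X : C) (p : state X), Support p) (X Y Z : C)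
    (f : Hom X Y) (g : Hom Y Z) (p : state X)
    (f' : Hom (S Y (f ∘ p) : C) (S X p))
    (g' : Hom (S Z (g ∘ (f ∘ p)) : C) (S Y (f ∘ p)))
    (e : supp (S Z (g ∘ f ∘ p)) = supp (S Z (g ∘ (f ∘ p)))) :
  bayes_inverse_supp f' -> bayes_inverse_supp g' ->
  bayes_inverse_supp (f := g ∘ f) (Xp := S X p) (Yfp := S Z (g ∘ f ∘ p))
    (f' ∘ g' ∘ hom_of_eq e).
Proof.
  unfold bayes_inverse_supp; intros Hf Hg.
  pose proof (bayes_inverse_comp Hf Hg) as H.
  (* The extension of the composite is the composite of the extensions. *)
  replace (supp_extend (f' ∘ g' ∘ hom_of_eq e)) with (supp_extend f' ∘ supp_extend g');
    [exact H |].
  unfold supp_extend; rewrite !comp_assoc, hom_of_eq_supp_r by apply comp_assoc.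
  rewrite <- (comp_assoc (supp_r (S Y (f ∘ p)))), supp_ri, comp_idl; reflexivity.
Qed.

Lemma functor_eq (C D : Category) (F G : Functor C D) : fdata F = fdata G -> F = G.
Proof.
  destruct F, G; simpl; intros ->; f_equal; apply proof_irrelevance.
Qed.

Theorem proposition21 (C : MarkovCategory)
    (has_inverses : forall (X Y : C) (f : Hom X Y) (p : state X),
       exists f' : Hom Y X, bayes_inverse f p f')
    (has_supports : forall (X : C) (p : state X), exists Xp : C, is_support p Xp) :
  inhabited (forall (X : C) (p : state X), Support p) /\
  forall S : (forall (X : C) (p : state X), Support p),
  exists fs : (forall (X Y : C) (f : Hom X Y) (p : state X), Hom (S Y (f ∘ p) : C) (S X p)),
    (forall (X Y : C) (f : Hom X Y) (p : state X),
       unique (@bayes_inverse_supp C X Y f p (S X p) (S Y (f ∘ p))) (fs X Y f p)) /\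
    exists T : Functor C (DBLens C),
      is_section (lens_proj C) T /\
      fdata T = {| fobj := support_lens_ob S;
                   fmap := fun (X Y : C) (f : Hom X Y) => support_lens fs f |}.
Proof.
  split.
  { constructor; intros X p.
    assert (H : inhabited (Support p))
      by (destruct (has_supports X p) as [Xp HXp]; exact (support_of_is_support HXp)).
    exact (epsilon H (fun _ => True)). }
  intros S.
  pose (inv := fun (X Y : C) (f : Hom X Y) (p : state X) =>
    constructive_indefinite_description _ (has_inverses X Y f p)).
  pose (fs := fun (X Y : C) (f : Hom X Y) (p : state X) =>
    supp_r (S X p) ∘ proj1_sig (inv X Y f p) ∘ supp_i (S Y (f ∘ p))).
  assert (Hfs : forall (X Y : C) (f : Hom X Y) (p : state X),
    bayes_inverse_supp (fs X Y f p))
    by (intros X Y f p; exact (bayes_inverse_supp_exists _ _ (proj2_sig (inv X Y f p)))).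
  exists fs; split.
  { intros X Y f p; split; [apply Hfs |].
    intros g Hg; exact (bayes_inverse_supp_unique (Hfs X Y f p) Hg). }
  assert (Tid : forall X : C,
    support_lens fs (idm X) = @lens_id C (support_lens_ob S X)).
  { intros X.
    apply (@lens_eq C _ _ (support_lens fs (idm X)) (lens_id (support_lens_ob S X)) eq_refl).
    intros p; simpl.
    rewrite comp_idr; apply (bayes_inverse_supp_unique (Hfs _ _ _ _)).
    apply bayes_inverse_supp_id. }
  assert (Tcomp : forall (X Y Z : C) (g : Hom Y Z) (f : Hom X Y),
    support_lens fs (g ∘ f) = lens_comp (support_lens fs g) (support_lens fs f)).
  { intros X Y Z g f.
    apply (@lens_eq C _ _ (support_lens fs (g ∘ f))
             (lens_comp (support_lens fs g) (support_lens fs f)) eq_refl).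
    intros p; simpl.
    rewrite comp_idr; apply (bayes_inverse_supp_unique (Hfs _ _ _ _)).
    apply bayes_inverse_supp_comp; apply Hfs. }
  exists (@Build_Functor C (DBLens C)
    {| fobj := support_lens_ob S;
       fmap := fun (X Y : C) (f : Hom X Y) => support_lens fs f |} Tid Tcomp).
  split; [apply functor_eq |]; reflexivity.
Qed.
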